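(* Let $\mathcal{H}$ be a complex separable Hilbert space, let $\mathcal{L}$ be a $\mathcal{J}$-subspace lattice on $\mathcal{H}$, and let $\mathcal{F}(\mathcal{H})$ be the set of finite rank operators on $\mathcal{H}$. Then $\mathrm{Alg}\,\mathcal{L}\cap\mathcal{F}(\mathcal{H})$ is a zero Lie product determined algebra.
   Context: A subspace lattice on $\mathcal{H}$ is a collection $\mathcal{L}$ of closed subspaces of $\mathcal{H}$ containing $(0)$ and $\mathcal{H}$ and such that for every family $\{S_r\}$ in $\mathcal{L}$ both $\bigcap S_r$ and $\bigvee S_r$ (closed linear span) belong to $\mathcal{L}$. $\mathrm{Alg}\,\mathcal{L}$ is the algebra of all bounded operators on $\mathcal{H}$ leaving every subspace in $\mathcal{L}$ invariant. For $K\in\mathcal{L}$ put $K_-=\bigvee\{L\in\mathcal{L}: L\not\supseteq K\}$, and let $\mathcal{J}(\mathcal{L})=\{K\in\mathcal{L}: K\ne\{0\}\text{ and }K_-\ne\mathcal{H}\}$. $\mathcal{L}$ is a $\mathcal{J}$-subspace lattice if (1) $\bigvee\{K:K\in\mathcal{J}(\mathcal{L})\}=\mathcal{H}$; (2) $\bigwedge\{K_-:K\in\mathcal{J}(\mathcal{L})\}=\{0\}$; (3) $K\vee K_-=\mathcal{H}$ for every $K\in\mathcal{J}(\mathcal{L})$; (4) $K\wedge K_-=\{0\}$ for every $K\in\mathcal{J}(\mathcal{L})$. An algebra $\mathcal{A}$ is zero Lie product determined if for every bilinear functional $\phi$ on $\mathcal{A}\times\mathcal{A}$ satisfying $\phi(x,y)=0$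 whenever $x$ and $y$ commute, there is a linear functional $\tau$ on $[\mathcal{A},\mathcal{A}]$ with $\phi(x,y)=\tau([x,y])$ for all $x,y\in\mathcal{A}$; here $[x,y]=xy-yx$ and $[\mathcal{A},\mathcal{A}]$ is the linear span of all commutators of $\mathcal{A}$. *)

(* Defs.v *)
From HB Require Import structures.
From mathcomp Require Import all_boot all_order all_algebra.
From mathcomp Require Export complex.
From mathcomp Require Import all_classical all_reals all_analysis.

Set Implicit Arguments.
Unset Strict Implicit.
Unset Printing Implicit Defensive.

Import Order.TTheory GRing.Theory Num.Theory.
Import numFieldNormedType.Exports.

Local Open Scope classical_set_scope.
Local Open Scope ring_scope.

Section LinearSpan.
Context {K : nzRingType} {V : lmodType K}.
Implicit Types (A S : set V).

Definition subspace_set S := submod_closed (mem S).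

Definition lin_span A : set V := smallest subspace_set A.

Definition finite_dimensional S :=
  exists s : seq V, S = lin_span [set x | x \in s].

Lemma subspace_setP S : subspace_set S <->
  S 0 /\ (forall a u v, S u -> S v -> S (a *: u + v)).
Proof.
split=> [[/set_mem S0 Slin]|[S0 Slin]].
  split=> // a u v Su Sv; apply/set_mem; apply: Slin; exact/mem_set.
split; first exact/mem_set.
by move=> a u v /set_mem Su /set_mem Sv; apply/mem_set/Slin.
Qed.

Lemma lin_span_subspace A : subspace_set (lin_span A).
Proof.
apply/subspace_setP; split=> [S [SS _]|a u v Au Av S SA].
  by have /subspace_setP[] := SS.
by have /subspace_setP[_ SS] := SA.1; apply: SS; [exact: Au|exact: Av].
Qed.

Lemma lin_span_sub A S : subspace_set S -> A `<=` S -> lin_span A `<=` S.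
Proof. by move=> SS AS; apply: smallest_sub. Qed.

Lemma sub_lin_span A : A `<=` lin_span A.
Proof. exact: sub_smallest. Qed.

Lemma lin_span_seq (s : seq V) : lin_span [set x | x \in s] =
  [set x | exists c : 'I_(size s) -> K, x = \sum_i c i *: s`_i].
Proof.
apply/seteqP; split=> [|_ [c ->]].
  apply: lin_span_sub.
    apply/subspace_setP; split.
      by exists (fun=> 0); rewrite big1 // => i _; rewrite scale0r.
    move=> a _ _ [c ->] [d ->]; exists (fun i => a * c i + d i).
    rewrite scaler_sumr -big_split /=; apply: eq_bigr => i _.
    by rewrite scalerA scalerDl.
  move=> x /= xs; have ix : (index x s < size s)%N by rewrite index_mem.
  exists (fun i => (i == Ordinal ix)%:R).
  rewrite (bigD1 (Ordinal ix)) //= eqxx scale1r nth_index // big1 ?addr0 //.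
  by move=> i /negPf ->; rewrite scale0r.
have /subspace_setP[S0 Slin] := lin_span_subspace [set x | x \in s].
have : forall i : 'I_(size s), lin_span [set x | x \in s] s`_i.
  by move=> i; apply: sub_lin_span => /=; rewrite mem_nth.
move=> H; elim/big_ind: _ => //.
- by move=> u v Su Sv; rewrite -[u]scale1r; apply: Slin.
- by move=> i _; rewrite -[_ *: _]addr0; apply: Slin.
Qed.

End LinearSpan.

Section FiniteDimensional.
Context {K : fieldType} {V : lmodType K}.
Implicit Types (A S : set V).

Lemma finite_dimensional_sub S S' : subspace_set S -> S `<=` S' ->
  finite_dimensional S' -> finite_dimensional S.
Proof.
move=> SS + [s sE]; rewrite {}sE lin_span_seq => Ss.
have /subspace_setP[S0 Slin] := SS.
set m := size s.
pose comb (c : 'rV[K]_m) : V := \sum_i c 0 i *: s`_i.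
have comb_lin a c d : comb (a *: c + d) = a *: comb c + comb d.
  rewrite /comb scaler_sumr -big_split /=; apply: eq_bigr => i _.
  by rewrite !mxE scalerA scalerDl.
have comb0 : comb 0 = 0.
  by rewrite /comb big1 // => i _; rewrite mxE scale0r.
pose P n := `[< exists A : 'M[K]_(n, m),
  row_free A /\ forall i, S (comb (row i A)) >].
have P0 : exists n, P n.
  by exists 0; apply/asboolP; exists 0; split; [rewrite -row_leq_rank|case].
have Pm n : P n -> (n <= m)%N.
  by move=> /asboolP[A [/eqP Afree _]]; rewrite -Afree rank_leq_col.
have [n /asboolP[A [Afree AS]] nmax] := ex_maxnP P0 Pm.
exists [seq comb (row i A) | i : 'I_n]; apply/seteqP; split; last first.
  by apply: lin_span_sub => // x /= /mapP[i _ ->].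
move=> x Sx; have [c xE] := Ss _ Sx.
pose r : 'rV[K]_m := \row_i c i.
have xr : x = comb r by rewrite xE; apply: eq_bigr => i _; rewrite mxE.
have rA : (r <= A)%MS.
  apply/negPn/negP => rA.
  suff /nmax : P (1 + n)%N by rewrite add1n ltnn.
  apply/asboolP; exists (col_mx r A); split.
    rewrite -row_leq_rank (leq_trans _ (rank_ltmx (_ : A < col_mx r A)%MS)) //.
      by rewrite ltnS (eqP Afree).
    rewrite /ltmx -!addsmxE addsmxSr /=; apply: contra rA.
    exact: submx_trans (addsmxSl _ _).
  move=> i; rewrite -(splitK i); case: (fintype.split i) => j /=.
    by rewrite rowKu ord1 row_id -xr.
  by rewrite rowKd.
have /submxP[d rE] := rA.
have -> : x = \sum_i d 0 i *: comb (row i A).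
  rewrite xr rE mulmx_sum_row.
  elim/big_rec2: _ => [//|i u v _ <-]; exact: comb_lin.
have /subspace_setP[T0 Tlin] :=
  lin_span_subspace [set y | y \in [seq comb (row i A) | i : 'I_n]].
elim/big_rec: _ => // i u _ Tu; apply: Tlin => //.
by apply: sub_lin_span => /=; apply/mapP; exists i; rewrite ?mem_enum.
Qed.

End FiniteDimensional.

(* Associative algebras, not assumed to be unital. *)
HB.mixin Record Lmodule_isNUAlgebra (K : nzRingType) A of GRing.Lmodule K A := {
  amul : A -> A -> A;
  amulA : associative amul;
  amul_bilinear : bilinear_for *:%R *:%R amul
}.

#[short(type="nuAlgType")]
HB.structure Definition NUAlgebra (K : nzRingType) :=
  {A of GRing.Lmodule K A & Lmodule_isNUAlgebra K A}.

Section ZeroLieProductDetermined.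
Context {K : nzRingType}.

Definition lie_bracket {A : nuAlgType K} (x y : A) : A := amul x y - amul y x.

Definition commutator_space (A : nuAlgType K) : set A :=
  lin_span [set lie_bracket x y | x in setT & y in setT].
Arguments commutator_space : clear implicits.

(* tau is a total function, but only its restriction to [A, A] is used. *)
Definition zero_lie_product_determined (A : nuAlgType K) : Prop :=
  forall phi : {biscalar A},
    (forall x y : A, amul x y = amul y x -> phi x y = 0) ->
  exists tau : A -> K,
    (forall (a : K) (u v : A), commutator_space A u -> commutator_space A v ->
       tau (a *: u + v) = a * tau u + tau v) /\
    (forall x y : A, phi x y = tau (lie_bracket x y)).

End ZeroLieProductDetermined.

Definition separable (T : topologicalType) : Prop :=
  exists2 D : set T, countable D & dense D.

Section SubspaceLattices.
Context {K : numFieldType}.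

Definition closed_subspace {H : normedModType K} (S : set H) : Prop :=
  subspace_set S /\ closed S.

Definition closed_span {H : normedModType K} (A : set H) : set H :=
  closure (lin_span A).

Definition bigjoin {H : normedModType K} (F : set (set H)) : set H :=
  closed_span (\bigcup_(S in F) S).

Record subspaceLattice (H : normedModType K) := SubspaceLattice {
  lattice_set :> set H -> Prop;
  lattice_closed_subspace : forall S, lattice_set S -> closed_subspace S;
  lattice_0 : lattice_set [set 0];
  lattice_T : lattice_set setT;
  lattice_bigcap : forall F, F `<=` lattice_set ->
    lattice_set (\bigcap_(S in F) S);
  lattice_bigjoin : forall F, F `<=` lattice_set -> lattice_set (bigjoin F)
}.

Section JSubspaceLattice.
Context {H : normedModType K} (L : subspaceLattice H).
Implicit Types M N : set H.

Definition lower M : set H := bigjoin [set N | L N /\ ~ (M `<=` N)].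

Definition Jset : set (set H) :=
  [set M | [/\ L M, M <> [set 0] & lower M <> setT]].

Definition J_subspace_lattice : Prop :=
  [/\ bigjoin Jset = setT,
      \bigcap_(M in Jset) lower M = [set 0],
      forall M, Jset M -> closed_span (M `|` lower M) = setT
    & forall M, Jset M -> M `&` lower M = [set 0]].

End JSubspaceLattice.

Section FiniteRankOperators.
Context {H : normedModType K}.
Implicit Types (S T : H -> H).

Definition bounded_operator T : Prop :=
  linear T /\ exists c : K, forall x, `|T x| <= c * `|x|.

Definition finite_rank T : Prop := finite_dimensional (range T).

Definition Alg (L : subspaceLattice H) : set (H -> H) :=
  [set T | bounded_operator T /\ forall M, L M -> T @` M `<=` M].

Definition alg_finite_rank (L : subspaceLattice H) : {pred H -> H} :=
  mem (Alg L `&` [set T | finite_rank T]).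

Lemma range_subspace T : linear T -> subspace_set (range T).
Proof.
move=> Tlin; apply/subspace_setP; split; last first.
  by move=> a _ _ [x _ <-] [y _ <-]; exists (a *: x + y) => //; exact: Tlin.
exists 0 => //; have := Tlin (-1) 0 0.
by rewrite !scaleN1r addNr addNr.
Qed.

Context (L : subspaceLattice H).

Lemma alg_finite_rank_submod_closed : submod_closed (alg_finite_rank L).
Proof.
split.
  apply/mem_set; split; [split; [split|]|].
  - by move=> a x y /=; rewrite scaler0 addr0.
  - by exists 0 => x; rewrite normr0 mul0r.
  - move=> M LM _ [x _ <-].
    by have [/subspace_setP[M0 _] _] := lattice_closed_subspace LM.
  - exists [::]; apply/seteqP; split=> [_ [x _ <-]|].
      by have /subspace_setP[] := lin_span_subspace [set x : H | x \in [::]].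
    apply: lin_span_sub => //; apply: range_subspace.
    by move=> a x y /=; rewrite scaler0 addr0.
move=> a S T /set_mem[[[Slin [c Sc]] SL] Sfin].
move=> /set_mem[[[Tlin [d Td]] TL] Tfin].
have STlin : linear (a *: S + T).
  move=> b x y; rewrite !fctE /= Slin Tlin !scalerDr !scalerA (mulrC a b).
  by rewrite addrACA.
apply/mem_set; split; [split; [split|]|] => //.
- exists (`|a| * c + d) => x; rewrite !fctE (le_trans (ler_normD _ _)) //.
  by rewrite mulrDl lerD // normrZ -mulrA ler_wpM2l.
- move=> M LM _ [x Mx <-].
  have [/subspace_setP[_ Mlin] _] := lattice_closed_subspace LM.
  by apply: Mlin; [apply: SL|apply: TL] => //; exists x.
- have [[s sE] [t tE]] := (Sfin, Tfin).
  have := lin_span_subspace [set x | x \in s ++ t].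
  move=> /subspace_setP[stlin0 stlin].
  apply: (@finite_dimensional_sub _ _ _ (lin_span [set x | x \in s ++ t])).
  + exact: range_subspace.
  + move=> _ [x _ <-]; apply: stlin.
      have : range S (S x) by exists x.
      rewrite sE; apply: lin_span_sub; first exact: lin_span_subspace.
      by move=> y /= ys; apply: sub_lin_span; rewrite /= mem_cat ys.
    have : range T (T x) by exists x.
    rewrite tE; apply: lin_span_sub; first exact: lin_span_subspace.
    by move=> y /= ys; apply: sub_lin_span; rewrite /= mem_cat ys orbT.
  + by exists (s ++ t).
Qed.

Lemma alg_finite_rank_comp S T :
  S \in alg_finite_rank L -> T \in alg_finite_rank L ->
  S \o T \in alg_finite_rank L.
Proof.
move=> /set_mem[[[Slin [c Sc]] SL] Sfin] /set_mem[[[Tlin [d Td]] TL] Tfin].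
have STlin : linear (S \o T) by move=> a x y /=; rewrite Tlin Slin.
apply/mem_set; split; [split; [split|]|] => //.
- exists (`|c| * d) => x /=; rewrite (le_trans (Sc _)) // -mulrA.
  have [->|Tx0] := eqVneq (T x) 0.
    by rewrite normr0 mulr0 mulr_ge0 // (le_trans _ (Td x)).
  have cr : 0 <= c.
    have := le_trans (normr_ge0 _) (Sc (T x)).
    by rewrite pmulr_lge0 // normr_gt0.
  by rewrite (ger0_norm cr) ler_wpM2l.
- move=> M LM _ [x Mx <-]; apply: SL => //; exists (T x) => //.
  by apply: TL => //; exists x.
- apply: finite_dimensional_sub Sfin; first exact: range_subspace.
  by move=> _ [x _ <-]; exists (T x).
Qed.

HB.instance Definition _ := GRing.isSubmodClosed.Build K (H -> H)
  (alg_finite_rank L) (GRing.submod_closed_semi alg_finite_rank_submod_closed).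

Record algFiniteRank := AlgFiniteRankOp {
  algFiniteRank_val :> H -> H;
  algFiniteRank_valP : algFiniteRank_val \in alg_finite_rank L
}.

HB.instance Definition _ := [isSub for algFiniteRank_val].
HB.instance Definition _ := [Choice of algFiniteRank by <:].
HB.instance Definition _ := [SubChoice_isSubLmodule of algFiniteRank by <:].

Definition algFiniteRank_mul (S T : algFiniteRank) : algFiniteRank :=
  AlgFiniteRankOp
    (alg_finite_rank_comp (algFiniteRank_valP S) (algFiniteRank_valP T)).

Lemma algFiniteRank_mulA : associative algFiniteRank_mul.
Proof. by move=> S T U; apply: val_inj. Qed.

Lemma algFiniteRank_mul_bilinear : bilinear_for *:%R *:%R algFiniteRank_mul.
Proof.
split=> [T a S S'|S a T T']; apply: val_inj => //=.
have /set_mem[[[Slin _] _] _] := algFiniteRank_valP S.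
by apply/funext => x; exact: Slin.
Qed.

HB.instance Definition _ :=
  Lmodule_isNUAlgebra.Build K algFiniteRank
    algFiniteRank_mulA algFiniteRank_mul_bilinear.

End FiniteRankOperators.
End SubspaceLattices.

(* Main.v *)
Require Import Defs.
From HB Require Import structures.
From mathcomp Require Import all_boot all_order all_algebra.
From mathcomp Require Import complex ring.
From mathcomp Require Import all_classical all_reals all_analysis.
Import Order.TTheory GRing.Theory Num.Theory.
Import numFieldNormedType.Exports.
Local Open Scope classical_set_scope.
Local Open Scope ring_scope.

Set Implicit Arguments.
Unset Strict Implicit.
Unset Printing Implicit Defensive.

(** Let A be the algebra of finite rank operators of Alg L. For M in J(L), a
    vector x of M and a bounded functional f vanishing on M_-, the operator
    [rank_one x f : v |-> f v *: x] belongs to A. The proof rests on two facts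
    about these operators.

    Local units ([local_right_unit]): for each T in A there is a finite sum E
    of such operators with T E = T, and one E serves for finitely many T at
    once ([common_right_units]). If T is not 0, then T z != 0 for some z in
    some M of J(L), because the M of J(L) span a dense subspace. As T z lies
    in M and M meets M_- in 0 only, T z is not in M_-. Subtracting from T z its
    orthogonal projection on the finite-dimensional space [M_- & range T]
    gives a vector w, and f = <T(.), w> / <T z, w> is a bounded functional
    that vanishes on M_- and on the kernel of T, with f z = 1. Then
    T - T (rank_one z f) has smaller rank than T, and induction applies.

    Traces ([rank_one_traces]): let phi be a bilinear functional on A that
    vanishes on commuting pairs. For each M there is a form beta_M with
      [phi (rank_one x f) (rank_one y g) = f y * beta_M x g - g x * beta_M y f];
    this is [rank_one_potential], a formal consequence of the fact that a
    bilinear form which vanishes on the orthogonal pairs of a pairing is a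
    multiple of this pairing. If M and N are distinct members of J(L), then
    M is contained in N_-, so the corresponding rank one operators annihilate
    each other and phi vanishes on them.

    Let now E = sum_i rank_one z_i h_i be a right unit for S and T, and put
    tau_E X = sum_i beta (X z_i) h_i. Expanding S = S E and T = T E gives
    phi S T = tau_E (S T) - tau_E (T S) = tau_E [S, T]. Since finitely many
    operators have a common right unit, sum_k phi S_k T_k depends only on
    sum_k [S_k, T_k], and this defines the linear functional on [A, A]
    ([zero_lie_product_determined_local_units]). *)

(** * Functionals vanishing on commuting pairs of rank one elements *)

(** If [p x h = 1] then [f - p x f *: h] is orthogonal to x, so
    [B x f = p x f * B x h]; the same reasoning in the first variable compares
    [B x h] with [B u h]. A general x is reduced to this case by adding to it a
    multiple of u. *)
Lemma bilinear_form_eq_pairing (K : fieldType) (X Y : lmodType K)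
    (p : {bilinear X -> Y -> K | *%R & *%R}) (B : X -> Y -> K) (u : X) (h : Y) :
    bilinear_for *%R *%R B -> p u h = 1 ->
    (forall x f, p x f = 0 -> B x f = 0) ->
  forall x f, B x f = p x f * B u h.
Proof.
move=> Bbil puh.
have [{Bbil} {}B ->] :
    exists B' : {bilinear X -> Y -> K | *%R & *%R}, B = B'.
  pose b := bilinear_isBilinear.Build K X Y K *%R *%R B Bbil.
  by exists (HB.pack_for {bilinear X -> Y -> K | *%R & *%R} B b).
move=> pB; have Bnorm x f : p x h = 1 -> B x f = p x f * B x h.
  move=> pxh; apply/eqP; rewrite -subr_eq0 -linearZr_LR -linearBr; apply/eqP.
  by apply: pB; rewrite linearBr linearZr_LR /= pxh mulr1 subrr.
move=> x f; pose c := 1 - p x h; pose y := x + c *: u.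
have pyh : p y h = 1.
  by rewrite linearDl linearZl_LR /= puh /c; ring.
have Byh : B y h = B u h.
  apply/eqP; rewrite -subr_eq0 -linearBl; apply/eqP/pB.
  by rewrite linearBl pyh puh subrr.
have -> : x = y - c *: u by rewrite addrK.
rewrite 2!linearBl !linearZl_LR /= (Bnorm y) // (Bnorm u) // Byh; ring.
Qed.

HB.instance Definition _ (K : nzRingType) (A : nuAlgType K) :=
  bilinear_isBilinear.Build K A A A *:%R *:%R amul (@amul_bilinear K A).

Section RankOneSystem.
Context {K : fieldType} {A : nuAlgType K} {X Y : lmodType K}.
Variables (p : {bilinear X -> Y -> K | *%R & *%R}) (r : {bilinear X -> Y -> A}).
Hypothesis rM : forall x f y g, amul (r x f) (r y g) = p y f *: r x g.
Variable phi : {biscalar A}.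
Hypothesis phi_comm : forall a b, amul a b = amul b a -> phi a b = 0.

Lemma alternating_of_comm a b : phi a b = - phi b a.
Proof.
have := @phi_comm (a + b) (a + b) erefl.
rewrite linearDl !linearDr /= (@phi_comm a a erefl) (@phi_comm b b erefl).
by rewrite addr0 add0r => /eqP; rewrite addr_eq0 => /eqP.
Qed.

(** If p = 0, any two elements [r x f], [r y g] commute and beta = 0 serves.
    Otherwise choose [p u h = 1] and put [beta x g = phi (r x h) (r u g)]. The
    difference d of both sides is bilinear in (x, g) and in (y, f), and it is
    antisymmetric under the exchange of (x, f) and (y, g). If [p x g = 0], then
    [phi (r x f) (r y g)] vanishes as soon as [p y f = 0], so it is a multiple of
    [p y f] and d is 0. Hence d is a multiple of [p x g] and, by antisymmetry, of
    [p y f] also: [d x f y g] is a multiple of [d u h u h = 0]. *)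
Lemma rank_one_potential : exists beta : X -> Y -> K,
  (forall g, scalar (beta^~ g)) /\
  (forall x f y g,
     phi (r x f) (r y g) = p y f * beta x g - p x g * beta y f).
Proof.
have phi0 x f y g : p y f = 0 -> p x g = 0 -> phi (r x f) (r y g) = 0.
  by move=> yf xg; apply: phi_comm; rewrite !rM yf xg !scale0r.
have [[u [h uh]]|p0] := pselect (exists u h, p u h = 1); last first.
  have {}p0 x f : p x f = 0.
    have [//|xf0] := eqVneq (p x f) 0; case: p0.
    by exists ((p x f)^-1 *: x), f; rewrite linearZl_LR /= mulVf.
  exists (fun _ _ => 0); split=> [g a x y|x f y g].
    by rewrite mulr0 addr0.
  by rewrite !mulr0 subr0 phi0.
pose beta x g := phi (r x h) (r u g).
exists beta; split=> [g a x y|x f y g].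
  by rewrite /beta !linearPl.
pose d x f y g :=
  phi (r x f) (r y g) - (p y f * beta x g - p x g * beta y f).
suff: d x f y g = 0 by move/eqP; rewrite subr_eq0 => /eqP.
have dC x1 f1 y1 g1 : d x1 f1 y1 g1 = - d y1 g1 x1 f1.
  by rewrite /d (alternating_of_comm (r x1 f1)); ring.
have d0 x1 f1 y1 g1 : p x1 g1 = 0 -> d x1 f1 y1 g1 = 0.
  move=> xg; rewrite /d xg mul0r subr0; apply/eqP; rewrite subr_eq0; apply/eqP.
  pose B y f := phi (r x1 f) (r y g1).
  have Bbil : bilinear_for *%R *%R B.
    by split=> [f' a z z'|z a f' f'']; rewrite /B ?linearPl ?linearPr ?linearPl.
  apply: (bilinear_form_eq_pairing Bbil uh _ y1 f1) => z f' zf'; exact: phi0.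
have d1 y1 f1 : forall x1 g1, d x1 f1 y1 g1 = p x1 g1 * d u f1 y1 h.
  pose B x g := d x f1 y1 g.
  have Bbil : bilinear_for *%R *%R B.
    split=> [g' a z z'|z a g' g'']; rewrite /B /d /beta.
      rewrite !linearPl /=; ring.
    rewrite !linearPr /=; ring.
  apply: (bilinear_form_eq_pairing Bbil uh) => z f' zf'; exact: d0.
rewrite d1 dC d1 /d uh phi_comm //; ring.
Qed.

End RankOneSystem.

(** * Algebras with local right units *)

Section LocalUnits.
Context {K : fieldType} {A : nuAlgType K} {I : Type} (r : I -> A).

(** Scalars are absorbed in the first factor of the brackets. *)
Lemma commutator_spaceP (u : A) : @commutator_space _ A u ->
  exists s : seq (A * A), u = \sum_(q <- s) lie_bracket q.1 q.2.
Proof.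
apply: (@lin_span_sub _ _ _ [set v : A | exists s : seq (A * A),
  v = \sum_(q <- s) lie_bracket q.1 q.2]).
- apply/subspace_setP; split=> [|a _ _ [s ->] [t ->]].
    by exists [::]; rewrite big_nil.
  exists ([seq (a *: q.1, q.2) | q <- s] ++ t).
  rewrite big_cat big_map /= scaler_sumr; congr (_ + _).
  apply: eq_bigr => q _.
  by rewrite /lie_bracket scalerBr linearZl_LR linearZr_LR.
- by move=> _ [x _ [y _ <-]]; exists [:: (x, y)]; rewrite big_seq1.
Qed.

Hypothesis local_units : forall s : seq A, exists t : seq I,
  forall x, x \in s -> amul x (\sum_(i <- t) r i) = x.

(** [tau i] plays the part of the map sending X to the trace of X (r i), for a
    trace twisted by phi: if e is a right unit of x and y and a sum of r i, and
    [tau_e] is the sum of the [tau i], then [phi x y = tau_e [x, y]]. So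
    [sum phi x_k y_k] is determined by [sum [x_k, y_k]], as finitely many
    elements have a common right unit. *)
Lemma zero_lie_product_determined_local_units :
  (forall phi : {biscalar A},
     (forall x y, amul x y = amul y x -> phi x y = 0) ->
   exists tau : I -> A -> K, (forall i, scalar (tau i)) /\
     forall x y i j, phi (amul x (r i)) (amul y (r j)) =
       tau j (amul x (amul (r i) y)) - tau i (amul y (amul (r j) x))) ->
  zero_lie_product_determined A.
Proof.
move=> H phi /H{H}[tau [tau_lin phi_tau]].
pose tauS t z := \sum_(i <- t) tau i z.
have tauSlin t : scalar (tauS t).
  move=> a x y; rewrite /tauS mulr_sumr -big_split /=.
  by apply: eq_bigr => i _; exact: tau_lin.
have tau_sum (i : I) (J : Type) (s : seq J) F :
    tau i (\sum_(j <- s) F j) = \sum_(j <- s) tau i (F j).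
  pose f : {scalar A} := HB.pack (tau i)
    (GRing.isLinear.Build K A K *%R (tau i) (tau_lin i)).
  exact: (linear_sum f).
have tauS_sum t (J : Type) (s : seq J) F :
    tauS t (\sum_(j <- s) F j) = \sum_(j <- s) tauS t (F j).
  by rewrite /tauS exchange_big /=; apply: eq_bigr => i _.
have phiE t x y : amul x (\sum_(i <- t) r i) = x ->
    amul y (\sum_(i <- t) r i) = y -> phi x y = tauS t (lie_bracket x y).
  move=> xt yt.
  have -> : phi x y =
      \sum_(i <- t) \sum_(j <- t) phi (amul x (r i)) (amul y (r j)).
    rewrite -{1}xt -{1}yt linear_sumr linear_sumlz; apply: eq_bigr => i _.
    by rewrite linear_sumr linear_sumr.
  under eq_bigr => i _ do
    [under eq_bigr => j _ do rewrite phi_tau; rewrite sumrB].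
  have -> : lie_bracket x y = -1 *: amul y x + amul x y.
    by rewrite scaleN1r addrC.
  rewrite tauSlin mulN1r addrC sumrB; congr (_ - _).
    rewrite exchange_big; apply: eq_bigr => j _ /=.
    by rewrite -tau_sum -linear_sumr -linear_sumlz /= amulA xt.
  apply: eq_bigr => i _.
  by rewrite -tau_sum -linear_sumr -linear_sumlz /= amulA yt.
(* A common right unit of all the entries of s and s' serves for both sums. *)
have phi_wd (s s' : seq (A * A)) :
    \sum_(q <- s) lie_bracket q.1 q.2 = \sum_(q <- s') lie_bracket q.1 q.2 ->
    \sum_(q <- s) phi q.1 q.2 = \sum_(q <- s') phi q.1 q.2.
  move=> ss'.
  have [t tP] := local_units (map fst (s ++ s') ++ map snd (s ++ s')).
  have sumE s0 : {subset s0 <= s ++ s'} -> \sum_(q <- s0) phi q.1 q.2 =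
      tauS t (\sum_(q <- s0) lie_bracket q.1 q.2).
    move=> s0s; rewrite tauS_sum; apply: eq_big_seq => q /s0s qs.
    by apply: phiE; apply: tP; rewrite mem_cat (map_f fst, map_f snd) ?orbT.
  by rewrite !sumE ?ss' // => q qs; rewrite mem_cat qs ?orbT.
have /choice[rep repP] : forall u : A, exists s : seq (A * A),
    @commutator_space _ A u -> u = \sum_(q <- s) lie_bracket q.1 q.2.
  move=> u.
  have [/commutator_spaceP[s us]|nu] := pselect (@commutator_space _ A u).
    by exists s.
  by exists [::].
have [_ Clin] := (subspace_setP _).1 (lin_span_subspace
  [set lie_bracket x y | x in @setT A & y in @setT A]).
exists (fun u => \sum_(q <- rep u) phi q.1 q.2); split=> [a u v uC vC|x y].
  rewrite (phi_wd _ ([seq (a *: q.1, q.2) | q <- rep u] ++ rep v)).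
    rewrite big_cat big_map /= mulr_sumr; congr (_ + _).
    by apply: eq_bigr => q _; rewrite linearZl_LR.
  rewrite -repP; last exact: Clin.
  rewrite big_cat big_map /= -repP // {1}(repP u uC) scaler_sumr.
  congr (_ + _); apply: eq_bigr => q _.
  by rewrite /lie_bracket scalerBr linearZl_LR linearZr_LR.
rewrite (phi_wd _ [:: (x, y)]) ?big_seq1 // -repP //.
by apply: sub_lin_span; exists x => //; exists y.
Qed.

End LocalUnits.

Section CombineUnits.
Context {K : fieldType} {A : nuAlgType K} {I : Type} (r : I -> A).
Hypothesis ideal : forall a t, exists t' : seq I,
  \sum_(i <- t') r i = \sum_(i <- t) r i - amul a (\sum_(i <- t) r i).

(** If [e1] is a sum of r i and [e2] is a right unit of [y - y e1], then
    [e1 + e2 - e1 e2] is a right unit of y and of each x with [x e1 = x]. *)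
Lemma combine_right_units y (t1 : seq I) :
    (exists t2, let y' := y - amul y (\sum_(i <- t1) r i) in
       amul y' (\sum_(i <- t2) r i) = y') ->
  exists t, amul y (\sum_(i <- t) r i) = y /\
    forall x, amul x (\sum_(i <- t1) r i) = x -> amul x (\sum_(i <- t) r i) = x.
Proof.
set e1 := \sum_(i <- t1) r i => -[t2]; set e2 := \sum_(i <- t2) r i => /= ye2.
have [t2' t2'E] := ideal e1 t2; exists (t1 ++ t2').
have xE x : amul x (\sum_(i <- t1 ++ t2') r i) =
    amul x e1 + amul (x - amul x e1) e2.
  by rewrite big_cat /= t2'E linearDr /= linearBr /= linearBl /= amulA.
split=> [|x xe1]; rewrite xE; first by rewrite ye2 addrC subrK.
by rewrite xe1 subrr linear0l addr0.
Qed.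

Lemma common_right_units :
    (forall y : A, exists t, amul y (\sum_(i <- t) r i) = y) ->
  forall s : seq A, exists t,
    forall x, x \in s -> amul x (\sum_(i <- t) r i) = x.
Proof.
move=> unit1; elim=> [|y s [t1 t1P]]; first by exists [::].
pose y' := y - amul y (\sum_(i <- t1) r i).
have [t [yt tP]] := combine_right_units (unit1 y').
by exists t => x; rewrite inE => /predU1P[->//|/t1P/tP].
Qed.

End CombineUnits.

(** * Linear spans and inner products *)

Section LinearFunctions.
Context {K : nzRingType} {U V : lmodType K} (f : U -> V).
Hypothesis flin : linear f.

Lemma linear_fun0 : f 0 = 0.
Proof. by have := flin (-1) 0 0; rewrite !scaleN1r !addNr. Qed.

Lemma linear_funZ a x : f (a *: x) = a *: f x.
Proof. by have := flin a x 0; rewrite linear_fun0 !addr0. Qed.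

End LinearFunctions.

Section LinearSpanSeq.
Context {K : fieldType} {V : lmodType K}.
Implicit Types (s : seq V) (x v : V).

Lemma lin_span_cons a s x : lin_span [set y | y \in a :: s] x ->
  exists c y, lin_span [set y | y \in s] y /\ x = c *: a + y.
Proof.
have /subspace_setP[S0 Slin] := lin_span_subspace [set y | y \in s].
apply: (@lin_span_sub _ _ _ [set x | exists c y,
  lin_span [set y | y \in s] y /\ x = c *: a + y]).
- apply/subspace_setP; split.
    by exists 0, 0; rewrite scale0r addr0.
  move=> b _ _ [c [y [Sy ->]]] [d [z [Sz ->]]].
  exists (b * c + d), (b *: y + z); split; first exact: Slin.
  by rewrite scalerDr scalerDl scalerA addrACA.
- move=> y /=; rewrite inE => /predU1P[->|ys].
    by exists 1, 0; rewrite scale1r addr0.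
  by exists 0, y; rewrite scale0r add0r; split=> //; exact: sub_lin_span.
Qed.

Lemma lin_span_map (W : lmodType K) (Q : V -> W) s x : linear Q ->
  lin_span [set y | y \in s] x -> lin_span [set y | y \in map Q s] (Q x).
Proof.
move=> Qlin.
have /subspace_setP[S0 Slin] := lin_span_subspace [set y | y \in map Q s].
apply: (@lin_span_sub _ _ _ [set x | lin_span [set y | y \in map Q s] (Q x)]).
- apply/subspace_setP; split=> [|a u v /= Su Sv] /=.
    by rewrite linear_fun0.
  by rewrite Qlin; exact: Slin.
- by move=> y /= ys; apply: sub_lin_span; exact: map_f.
Qed.

(** This replaces a dimension count. Write v in terms of the vectors of s: the
    first vector of s with a nonzero coefficient has its image under Q in the
    span of the images of the later vectors, and can be dropped. *)
Lemma lin_span_shrink (W : lmodType K) (Q : V -> W) s v :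
    linear Q -> Q v = 0 -> v != 0 -> lin_span [set y | y \in s] v ->
  exists2 s' : seq W, (size s' < size s)%N &
    forall x, lin_span [set y | y \in s] x -> lin_span [set y | y \in s'] (Q x).
Proof.
move=> Qlin Qv0.
elim: s v Qv0 => [|a s IHs] v Qv0 v0.
  rewrite lin_span_seq => -[c vE]; case/eqP: v0; rewrite vE.
  by rewrite big1 // => -[].
move=> /lin_span_cons[c [v' [sv' vE]]].
have [c0|c0] := eqVneq c 0.
  rewrite c0 scale0r add0r in vE; rewrite -vE {vE c c0} in sv'.
  have [s' ss' s'P] := IHs v Qv0 v0 sv'.
  exists (Q a :: s') => // x /lin_span_cons[d [y [sy ->]]].
  have /subspace_setP[_ Slin] := lin_span_subspace [set y | y \in Q a :: s'].
  rewrite Qlin; apply: Slin; first by apply: sub_lin_span; rewrite /= mem_head.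
  apply: lin_span_sub (s'P _ sy); first exact: lin_span_subspace.
  by move=> z /= zs'; apply: sub_lin_span; rewrite /= inE zs' orbT.
exists (map Q s); rewrite ?size_map // => x /lin_span_cons[d [y [sy ->]]].
have /subspace_setP[S0 Slin] := lin_span_subspace [set y | y \in map Q s].
have Qa : Q a = - c^-1 *: Q v'.
  move: Qv0; rewrite vE Qlin => /eqP; rewrite addr_eq0 => /eqP Qca.
  by rewrite scaleNr -scalerN -Qca scalerA mulVf // scale1r.
by rewrite Qlin Qa scalerA; apply: Slin; exact: lin_span_map.
Qed.

End LinearSpanSeq.

Section InnerProduct.
Context {C : numClosedFieldType} {V : lmodType C}.
Variable dot : {dot V for @Num.conj C}.

Lemma dot_cauchy_schwarz u v : `|dot u v| ^+ 2 <= dot u u * dot v v.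
Proof.
have [->|v0] := eqVneq v 0; first by rewrite linear0r normr0 expr0n mulr_ge0.
pose a := dot u v / dot v v; pose w := u - a *: v.
have wv : dot w v = 0.
  by rewrite linearBl linearZl_LR /= divfK ?dnorm_eq0 // subrr.
have -> : u = w + a *: v by rewrite subrK.
rewrite hnormDd /=; last by rewrite linearZr_LR /= wv mulr0.
rewrite linearDl /= wv add0r linearZl_LR /= normrM exprMn dnormZ mulrDl.
rewrite (ger0_norm (dnorm_ge0 _ _)) expr2 mulrA lerDr.
by rewrite mulr_ge0.
Qed.

Lemma dot_span_eq0 (A : set V) u : (forall y, A y -> dot u y = 0) ->
  forall y, lin_span A y -> dot u y = 0.
Proof.
move=> uA; apply: (@lin_span_sub _ _ _ [set y | dot u y = 0]) => //.
apply/subspace_setP; split=> [|a y z /= y0 z0]; first by rewrite /= linear0r.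
by rewrite linearPr /= y0 z0 mulr0 addr0.
Qed.

(** One step of the Gram-Schmidt process: for w the component of a orthogonal
    to s, the projection of x on the span of [a :: s] is its projection on the
    span of s plus its component along w. *)
Lemma orthogonal_projection (s : seq V) x :
  exists p, lin_span [set y | y \in s] p /\
  forall y, lin_span [set y | y \in s] y -> dot (x - p) y = 0.
Proof.
suff [p [sp px]] : exists p, lin_span [set y | y \in s] p /\
    forall y, y \in s -> dot (x - p) y = 0.
  by exists p; split=> //; exact: dot_span_eq0.
elim: s x => [|a s IHs] x.
  exists 0; split=> //.
  by have /subspace_setP[] := lin_span_subspace [set y : V | y \in [::]].
have sub : lin_span [set y | y \in s] `<=` lin_span [set y | y \in a :: s].
  apply: lin_span_sub; first exact: lin_span_subspace.
  by move=> z /= zs; apply: sub_lin_span; rewrite /= inE zs orbT.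
have /subspace_setP[S0 Slin] := lin_span_subspace [set y | y \in a :: s].
have [q [sq qa]] := IHs a; have [p [sp px]] := IHs x.
pose w := a - q; pose b := dot (x - p) w / dot w w.
have res y : y \in s -> dot (x - (b *: w + p)) y = 0.
  move=> ys; rewrite opprD addrCA linearDl linearNl linearZl_LR /= px // qa //.
  by rewrite mulr0 oppr0 addr0.
exists (b *: w + p); split.
  apply: (Slin); last exact: sub.
  rewrite /w addrC -scaleN1r; apply: Slin; first exact: sub.
  by apply: sub_lin_span; rewrite /= mem_head.
move=> y; rewrite inE => /predU1P[->|]; last exact: res.
have -> : a = w + q by rewrite subrK.
have resq : dot (x - (b *: w + p)) q = 0.
  exact: (dot_span_eq0 (A := [set y | y \in s]) res sq).
rewrite linearDr /= resq addr0 opprD addrCA addrC linearBl linearZl_LR /= /b.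
have [->|w0] := eqVneq w 0; first by rewrite linear0r !mul0r subrr.
by rewrite divfK ?dnorm_eq0 // subrr.
Qed.

End InnerProduct.

(** * Rank one operators in Alg L *)

(** A subspace given as a set is turned into a module, so that spaces of vectors
    and of functionals attached to J(L) can be paired by bilinear maps. *)
Section Submodule.
Context {K : nzRingType} {V : lmodType K} {S : set V}.

Definition subspace_pred of subspace_set S : {pred V} := mem S.

HB.instance Definition _ (SS : subspace_set S) :=
  GRing.isSubmodClosed.Build K V (subspace_pred SS)
    (GRing.submod_closed_semi (SS : submod_closed (subspace_pred SS))).

Record submodule (SS : subspace_set S) := Submodule {
  submodule_val :> V;
  submodule_valP : submodule_val \in subspace_pred SS
}.

HB.instance Definition _ SS := [isSub for @submodule_val SS].
HB.instance Definition _ SS := [Choice of submodule SS by <:].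
HB.instance Definition _ SS := [SubChoice_isSubLmodule of submodule SS by <:].

Lemma submodule_mem SS (x : submodule SS) : S x.
Proof. exact/set_mem/submodule_valP. Qed.

Definition to_submodule SS x (Sx : S x) : submodule SS :=
  @Submodule SS x (mem_set Sx).

End Submodule.

Section RankOneOperators.
Context {K : numFieldType} {H : normedModType K}.

Definition Jspace (L : subspaceLattice H) := {M : set H | Jset L M}.

Context {L : subspaceLattice H}.

Lemma algFiniteRank_linear (T : algFiniteRank L) : linear T.
Proof. by have /set_mem[[[]]] := algFiniteRank_valP T. Qed.

Lemma algFiniteRankZ (T : algFiniteRank L) a x : T (a *: x) = a *: T x.
Proof. exact/linear_funZ/algFiniteRank_linear. Qed.

Lemma algFiniteRank_invariant (T : algFiniteRank L) M x : L M -> M x -> M (T x).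
Proof.
have /set_mem[[_ TL] _] := algFiniteRank_valP T.
by move=> LM Mx; apply: TL => //; exists x.
Qed.

Lemma lattice_subspace M : L M -> subspace_set M.
Proof. by case/lattice_closed_subspace. Qed.

Lemma lattice_lower M : L (lower L M).
Proof. by apply: lattice_bigjoin => N []. Qed.

Lemma sub_lower M N : L N -> ~ (M `<=` N) -> N `<=` lower L M.
Proof.
move=> LN MN x Nx; apply: subset_closure; apply: sub_lin_span.
by exists N.
Qed.

Definition lower_annihilator M : set (H -> K^o) :=
  [set f | [/\ scalar f, exists c : K, forall x, `|f x| <= c * `|x|
    & forall x, lower L M x -> f x = 0]].

Lemma lower_annihilator_subspace M : subspace_set (lower_annihilator M).
Proof.
apply/subspace_setP; split.
  split=> [a x y|| //]; first by rewrite /= mulr0 addr0.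
  by exists 0 => x; rewrite normr0 mul0r.
move=> a f g [flin [c fc] f0] [glin [d gd] g0]; split.
- by move=> b x y; rewrite !fctE /= flin glin /GRing.scale /=; ring.
- exists (`|a| * c + d) => x; rewrite !fctE (le_trans (ler_normD _ _)) //.
  by rewrite mulrDl lerD // normrM -mulrA ler_wpM2l.
- by move=> x xM; rewrite !fctE f0 // g0 // scaler0 addr0.
Qed.

Lemma Jset_lattice M : Jset L M -> L M.
Proof. by case. Qed.

Lemma Jset_subspace M : Jset L M -> subspace_set M.
Proof. by move=> /Jset_lattice/lattice_subspace. Qed.

Definition Jvector (M : Jspace L) := submodule (Jset_subspace (svalP M)).
Definition Jfunctional (M : Jspace L) :=
  submodule (lower_annihilator_subspace (sval M)).

HB.instance Definition _ M := GRing.Lmodule.on (Jvector M).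
HB.instance Definition _ M := GRing.Lmodule.on (Jfunctional M).

Definition Jval (M : Jspace L) (x : Jvector M) : H := submodule_val x.
Coercion Jval : Jvector >-> NormedModule.sort.

Definition Jeval (M : Jspace L) (f : Jfunctional M) : H -> K := submodule_val f.
Coercion Jeval : Jfunctional >-> Funclass.

Lemma Jval_mem (M : Jspace L) (x : Jvector M) : sval M x.
Proof. exact: (submodule_mem x). Qed.

Lemma JevalP (M : Jspace L) (f : Jfunctional M) :
  [/\ scalar f, exists c : K, forall x, `|f x| <= c * `|x|
    & forall x, lower L (sval M) x -> f x = 0].
Proof. exact: (submodule_mem f). Qed.

Section OneJspace.
Variable M : Jspace L.
Implicit Types (x y : Jvector M) (f g : Jfunctional M).

(** A member N of the lattice either contains M, hence x, or is contained in
    M_-, where f vanishes. *)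
Lemma rank_one_mem x f :
  (fun v => f v *: (x : H)) \in alg_finite_rank L.
Proof.
have [flin [c fc] f0] := JevalP f.
have xlin : linear (fun v => f v *: (x : H)).
  by move=> a u v; rewrite flin scalerDl scalerA.
apply/mem_set; split; [split; [split|]|] => //.
- by exists (c * `|x : H|) => v; rewrite normrZ mulrAC ler_wpM2r.
- move=> N LN _ [v Nv <-].
  have /subspace_setP[N0 Nlin] := lattice_subspace LN.
  have [MN|MN] := pselect (sval M `<=` N).
    rewrite -[_ *: _]addr0; apply: Nlin => //; apply: MN; exact: Jval_mem.
  by rewrite f0 ?scale0r //; apply: sub_lower Nv.
- apply: (@finite_dimensional_sub _ _ _ (lin_span [set y | y \in [:: x : H]])).
  + exact: range_subspace.
  + have /subspace_setP[S0 Slin] :=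
      lin_span_subspace [set y | y \in [:: x : H]].
    move=> _ [v _ <-]; rewrite -[_ *: _]addr0; apply: Slin => //.
    by apply: sub_lin_span; rewrite /= inE.
  + by eexists.
Qed.

Definition rank_one x f : algFiniteRank L := AlgFiniteRankOp (rank_one_mem x f).

Lemma rank_one_bilinear : bilinear_for *:%R *:%R rank_one.
Proof.
split=> [f a x y|x a f g]; apply: val_inj; apply/funext => v /=.
  by rewrite !fctE scalerDr !scalerA mulrC.
by rewrite !fctE scalerDl scalerA.
Qed.

HB.instance Definition _ :=
  bilinear_isBilinear.Build K (Jvector M) (Jfunctional M) (algFiniteRank L)
    *:%R *:%R rank_one rank_one_bilinear.

Definition Jpairing x f : K := f x.

Lemma Jpairing_bilinear : bilinear_for *%R *%R Jpairing.
Proof.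
split=> [f a x y|//]; have [flin _ _] := JevalP f.
exact: flin.
Qed.

HB.instance Definition _ :=
  bilinear_isBilinear.Build K (Jvector M) (Jfunctional M) K
    *%R *%R Jpairing Jpairing_bilinear.

(** The action of Alg L on M, which it leaves invariant. *)
Definition Jact (T : algFiniteRank L) x : Jvector M :=
  to_submodule (Jset_subspace (svalP M))
    (algFiniteRank_invariant T (Jset_lattice (svalP M)) (Jval_mem x)).

Lemma mul_rank_one T x f : amul T (rank_one x f) = rank_one (Jact T x) f.
Proof.
by apply: val_inj; apply/funext => v /=; rewrite /= algFiniteRankZ.
Qed.

Lemma rank_one_mul x f y g :
  amul (rank_one x f) (rank_one y g) = Jpairing y f *: rank_one x g.
Proof.
rewrite mul_rank_one -linearZl_LR; congr (rank_one _ _); exact: val_inj.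
Qed.

End OneJspace.
End RankOneOperators.

(** * J-subspace lattices *)

Section JSubspaceLattice.
Context {K : numFieldType} {H : normedModType K} {L : subspaceLattice H}.
Hypothesis L_J : J_subspace_lattice L.

Lemma Jspace_meet_lower (M : Jspace L) x :
  sval M x -> lower L (sval M) x -> x = 0.
Proof.
case: L_J => _ _ _ ML Mx Lx.
by have : (sval M `&` lower L (sval M)) x by []; rewrite ML //; exact: svalP.
Qed.

(** Distinct members of J(L) are incomparable: if N were contained in M but not
    equal to it, then N would be contained in M_-, as M is not contained in N,
    and hence in the intersection 0 of M and M_-. *)
Lemma Jspace_sub_lower (M N : Jspace L) :
  sval M <> sval N -> sval M `<=` lower L (sval N).
Proof.
move=> MN; have [LM M0 _] := svalP M; have [LN N0 _] := svalP N.
apply: sub_lower => // NM; apply: N0; apply/seteqP; split=> [x Nx|x ->].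
  apply: (@Jspace_meet_lower M); first exact: NM.
  by apply: (sub_lower LN) Nx => MN'; apply: MN; apply/seteqP; split.
by have /subspace_setP[] := lattice_subspace LN.
Qed.

Definition rank_one_index := {M : Jspace L & Jvector M * Jfunctional M}%type.

Definition rank_one_of (i : rank_one_index) : algFiniteRank L :=
  rank_one (projT2 i).1 (projT2 i).2.

(** On each M, [tau i X = beta (X z) h] for i = (z, h) and the form beta of
    [rank_one_potential]. When i and j belong to distinct members of J(L), both
    sides vanish because the rank one operators annihilate each other. *)
Lemma rank_one_traces (phi : {biscalar (algFiniteRank L)}) :
    (forall S T, amul S T = amul T S -> phi S T = 0) ->
  exists tau : rank_one_index -> algFiniteRank L -> K,
    (forall i, scalar (tau i)) /\
    forall S T i j, phi (amul S (rank_one_of i)) (amul T (rank_one_of j)) =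
      tau j (amul S (amul (rank_one_of i) T)) -
      tau i (amul T (amul (rank_one_of j) S)).
Proof.
move=> phi_comm.
pose isbeta (M : Jspace L) (beta : Jvector M -> Jfunctional M -> K) :=
  (forall g, scalar (beta^~ g)) /\ forall x f y g,
    phi (rank_one x f) (rank_one y g) =
    Jpairing y f * beta x g - Jpairing x g * beta y f.
have betaP (M : Jspace L) : exists beta, isbeta M beta.
  exact: (rank_one_potential (@rank_one_mul _ _ _ M) phi_comm).
pose beta M := sval (cid (betaP M)).
have beta_spec M : isbeta M (beta M) by exact: svalP (cid (betaP M)).
pose tau (i : rank_one_index) X := beta _ (Jact X (projT2 i).1) (projT2 i).2.
exists tau; split=> [[M [z h]] a S T|S T [M [z h]] [N [y g]]].
  by rewrite /tau /= -(beta_spec M).1; congr beta; exact: val_inj.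
have beta0 Q f : beta Q 0 f = 0.
  by have := (beta_spec Q).1 f (-1) 0 0; rewrite scaler0 addr0 mulN1r addNr.
rewrite /rank_one_of /tau /=.
have act_rank_one (Q : Jspace L) (x : Jvector Q) f S1 T1 (y1 : Jvector Q) :
    Jact (amul S1 (amul (rank_one x f) T1)) y1 =
    Jpairing (Jact T1 y1) f *: Jact S1 x.
  by apply: val_inj; rewrite /= algFiniteRankZ.
have act_rank_one0 (P Q : Jspace L) (x : Jvector P) f S1 T1 (y1 : Jvector Q) :
    sval P <> sval Q -> Jact (amul S1 (amul (rank_one x f) T1)) y1 = 0.
  move=> PQ; apply: val_inj => /=; have [_ _ f0] := JevalP f.
  rewrite algFiniteRankZ f0 ?scale0r //.
  apply: (Jspace_sub_lower (nesym PQ)).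
  exact: (Jval_mem (Jact T1 y1)).
have [MN|MN] := pselect (sval M = sval N); last first.
  rewrite !act_rank_one0 //; last exact: nesym.
  rewrite !beta0 subrr !mul_rank_one; apply: phi_comm.
  have rr0 (P Q : Jspace L) (x : Jvector P) f (y1 : Jvector Q) f1 :
      sval P <> sval Q ->
      amul (rank_one x f) (rank_one y1 f1) = 0.
    move=> PQ; rewrite mul_rank_one.
    suff -> : Jact (rank_one x f) y1 = 0 by rewrite linear0l.
    apply: val_inj => /=; have [_ _ f0] := JevalP f.
    rewrite f0 ?scale0r //; apply: (Jspace_sub_lower (nesym PQ)).
    exact: Jval_mem.
  by rewrite !rr0 //; exact: nesym.
have {MN} MN : M = N by exact: eq_sig_hprop MN.
case: N / MN in y g *.
rewrite !mul_rank_one (beta_spec M).2 !act_rank_one.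
have betaZ a x f : beta M (a *: x) f = a * beta M x f.
  by have := (beta_spec M).1 f a x 0; rewrite beta0 !addr0.
by rewrite !betaZ.
Qed.

Lemma closed_span_sub_kernel (T : H -> H) (S : set H) :
  bounded_operator T -> (forall x, S x -> T x = 0) ->
  forall x, closed_span S x -> T x = 0.
Proof.
move=> [Tlin [c Tc]] TS x Sx.
have T0 := linear_fun0 Tlin.
have kerS y : lin_span S y -> T y = 0.
  move=> Sy; have : [set y | T y = 0] y; last by [].
  apply: (lin_span_sub _ _ Sy) => //; apply/subspace_setP; split=> // a u v /=.
  by rewrite Tlin => -> ->; rewrite scaler0 addr0.
apply/eqP/negPn/negP => Tx0.
have c0 : 0 < c.
  have : 0 < c * `|x| by apply: lt_le_trans (Tc x); rewrite normr_gt0.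
  by rewrite pmulr_lgt0 // normr_gt0; apply: contraNneq Tx0 => ->; rewrite T0.
have e0 : 0 < `|T x| / c by rewrite divr_gt0 ?normr_gt0.
have [y [Sy]] := Sx _ (nbhsx_ballx x _ e0).
rewrite -ball_normE /= ltr_pdivlMr // mulrC => xy.
have := le_lt_trans (Tc (x - y)) xy.
suff -> : T (x - y) = T x by rewrite ltxx.
by have := Tlin (-1) y x; rewrite (kerS _ Sy) scaler0 add0r scaleN1r addrC.
Qed.

(** The members of J(L) span a dense subspace. *)
Lemma algFiniteRank_eq0 (T : algFiniteRank L) :
  (forall (M : Jspace L) (z : Jvector M), T z = 0) -> T = 0.
Proof.
move=> T0; apply: val_inj; apply/funext => x /=.
have /set_mem[[Tbdd _] _] := algFiniteRank_valP T.
apply: (closed_span_sub_kernel Tbdd (S := \bigcup_(S in Jset L) S)) => [y|].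
  move=> [M JM My]; pose N : Jspace L := exist _ M JM.
  exact: (T0 N (to_submodule (Jset_subspace (svalP N)) My)).
by case: L_J => JT _ _ _; have : (@setT H) x by []; rewrite -JT.
Qed.

End JSubspaceLattice.

(** * Local right units in the algebra of finite rank operators *)

Section LocalUnitsInAlg.
Context {C : numClosedFieldType} {H : normedModType C} {L : subspaceLattice H}.
Variable dot : {dot H for @Num.conj C}.
Hypothesis dot_norm : forall x : H, `|x| ^+ 2 = dot x x.
Hypothesis L_J : J_subspace_lattice L.

(** This holds because T r is a rank one operator of the same kind whenever r is
    one. *)
Lemma rank_one_ideal (T : algFiniteRank L) t : exists t',
  \sum_(i <- t') rank_one_of (L := L) i =
  \sum_(i <- t) rank_one_of i - amul T (\sum_(i <- t) rank_one_of i).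
Proof.
exists [seq existT _ (projT1 i)
  ((projT2 i).1 - Jact T (projT2 i).1, (projT2 i).2) | i <- t].
rewrite big_map linear_sumr -sumrB; apply: eq_bigr => i _.
by rewrite /rank_one_of /= linearBl /= -mul_rank_one.
Qed.

Lemma dot_functional_bounded (T : algFiniteRank L) (w : H) a :
  exists c : C, forall x, `|dot (T x) w / a| <= c * `|x|.
Proof.
have /set_mem[[[_ [c Tc]] _] _] := algFiniteRank_valP T.
exists (c * `|w| / `|a|) => x.
rewrite normrM normfV mulrAC ler_wpM2r ?invr_ge0 //.
have CS : `|dot (T x) w| <= `|T x| * `|w|.
  rewrite -(@ler_pXn2r _ 2) ?nnegrE ?mulr_ge0 // exprMn !dot_norm.
  exact: dot_cauchy_schwarz.
by rewrite (le_trans CS) // mulrAC ler_wpM2r.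
Qed.

(** The functional of the rank one operator factors through T, as
    [<T(.), w> / <T z, w>], so that right multiplication by the complement of
    this operator amounts to left multiplication by a map Q, which kills the
    vector T z of the range. Here w is orthogonal to the intersection of M_- and
    the range of T; being finite-dimensional, this intersection has an
    orthogonal projection. *)
Lemma rank_reducing_rank_one (T : algFiniteRank L) : T != 0 ->
  exists (i : rank_one_index (L := L)) (Q : H -> H) (v : H),
    [/\ linear Q, v != 0, range T v, Q v = 0
      & forall x, (T - amul T (rank_one_of i)) x = Q (T x)].
Proof.
move=> T0.
have [M [z Tz0]] : exists (M : Jspace L) (z : Jvector M), T z != 0.
  apply: contrapT => nz; case/eqP: T0; apply: (algFiniteRank_eq0 L_J) => M z.
  by apply/eqP/negPn/negP => Tz; apply: nz; exists M, z.
have Tlin := algFiniteRank_linear T.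
have rangeT := range_subspace Tlin.
have LL := lattice_subspace (lattice_lower (L := L) (sval M)).
have [s sE] : finite_dimensional (lower L (sval M) `&` range T).
  have /set_mem[_ Tfin] := algFiniteRank_valP T.
  apply: finite_dimensional_sub Tfin => [|x []//].
  have /subspace_setP[L0 Llin] := LL.
  have /subspace_setP[R0 Rlin] := rangeT.
  apply/subspace_setP; split=> // a u v [Lu Ru] [Lv Rv].
  by split; [exact: Llin|exact: Rlin].
have [p []] := orthogonal_projection dot s (T z).
rewrite -sE => Wp orth; pose w := T z - p.
have w0 : w != 0.
  apply: contra_neq Tz0 => /eqP; rewrite subr_eq0 => /eqP Tzp.
  apply: (@Jspace_meet_lower _ _ _ L_J M); last by rewrite Tzp; case: Wp.
  exact: (Jval_mem (Jact T z)).
have {orth} orth y : lower L (sval M) y -> range T y -> dot y w = 0.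
  by move=> Ly Ry; apply/eqP; rewrite herm_eq0C; apply/eqP/orth; split.
pose a := dot (T z) w.
have aE : a = dot w w.
  rewrite /a -{1}(subrK p (T z)) linearDl /= [dot p w]orth ?addr0 //.
    by case: Wp.
  by case: Wp.
have a0 : a != 0 by rewrite aE dnorm_eq0.
pose h : H -> C^o := fun x => dot (T x) w / a.
have hM : lower_annihilator (L := L) (sval M) h.
  split=> [b x y||x Lx]; rewrite /h.
  - by rewrite Tlin linearPl /=; ring.
  - exact: dot_functional_bounded.
  - rewrite orth ?mul0r //.
    exact: (algFiniteRank_invariant T (lattice_lower _)).
pose f : Jfunctional M := to_submodule (lower_annihilator_subspace (sval M)) hM.
exists (existT _ M (z, f)), (fun y => y - (dot y w / a) *: T z), (T z).
split=> //.
- move=> b x y; rewrite linearPl /= scalerBr addrACA -opprD; congr (_ - _).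
  by rewrite scalerA -scalerDl; congr (_ *: _); ring.
- by rewrite divff // scale1r subrr.
- by move=> x; rewrite -algFiniteRankZ.
Qed.

(** Induction on the size of a family spanning the range of T. *)
Lemma local_right_unit (T : algFiniteRank L) :
  exists t, amul T (\sum_(i <- t) rank_one_of (L := L) i) = T.
Proof.
have /set_mem[_ [s sE]] := algFiniteRank_valP T.
have {sE} : forall x, lin_span [set y | y \in s] (T x).
  by move=> x; rewrite -sE; exists x.
have [n] := ubnP (size s); elim: n T s => // n IHn T s sn Ts.
have [->|T0] := eqVneq T 0; first by exists [::]; rewrite linear0l.
have [i [Q [v [Qlin v0 [x _ vE] Qv TQ]]]] := rank_reducing_rank_one T0.
have vs : lin_span [set y | y \in s] v by rewrite -vE.
have [s' s's Qs'] := lin_span_shrink Qlin Qv v0 vs.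
have [|y|t tE] := IHn (T - amul T (rank_one_of i)) s'.
- exact: leq_trans s's _.
- by rewrite TQ; exact: Qs'.
have [|t' [t'T _]] :=
    combine_right_units rank_one_ideal (y := T) (t1 := [:: i]).
  by exists t; rewrite big_seq1.
by exists t'.
Qed.

End LocalUnitsInAlg.

Theorem theorem7 (R : realType) (H : completeNormedModType R[i])
    (dot : {dot H for @Num.conj R[i]})
    (dot_norm : forall x : H, `|x| ^+ 2 = dot x x)
    (H_separable : separable H)
    (L : subspaceLattice H) (L_J : J_subspace_lattice L) :
  zero_lie_product_determined (algFiniteRank L).
Proof.
apply: (zero_lie_product_determined_local_units (r := @rank_one_of _ _ L)).
- apply: (common_right_units (@rank_one_ideal _ _ L)) => T.
  exact: (local_right_unit dot_norm L_J).
- exact: rank_one_traces L_J.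
Qed.
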